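(* Let $m$ and $n$ be two positive integers with $n\ge m$ and suppose $\lambda>-\frac12$ is nonzero. The coefficients $\widetilde\rho_{j,n}^{\,m;(\lambda)}$, $0\le j\le m+n+1$, in the expansion $$\int_{-1}^{x+1}C_m^{(\lambda)}(x-t)C_n^{(\lambda)}(t)\,dt=\sum_{j=0}^{m+n+1}\widetilde\rho_{j,n}^{\,m;(\lambda)}C_j^{(\lambda)}(x+1)$$ can be expressed as $$\widetilde\rho_{j,n}^{\,m;(\lambda)}=\sum_{\nu=\max(1,|j-n|)}^{m+1}\widetilde\varpi_{j,\nu}^{m,n}(\lambda)\quad\text{for } j\ge\max(m+1,n-m-1),$$ $$\widetilde\rho_{j,n}^{\,m;(\lambda)}=0\quad\text{for } m+1\le j\le n-m-2,\ \text{if } n\ge2m+3,$$ $$\widetilde\rho_{j,n}^{\,m;(\lambda)}=\sum_{\nu=1}^j\widetilde\varpi_{j,\nu}^{n,m}(\lambda)+\sum_{\nu=j+1}^{n+1}\widetilde d_{\nu,j,n}^{\,m}(\lambda)\quad\text{for }0\le j\le m,$$ where $$\widetilde\varpi_{j,\nu}^{m,n}(\lambda)=\frac{(j+\lambda)(-1)^{m+\nu+1}(\lambda)_{\nu-1}(2\lambda+2\nu-2)_{m-\nu+1}(-\nu)_{\frac{-j+n+\nu}{2}}}{2\,(m-\nu+1)!\left(\frac{-j+\nu+n}{2}\right)!\left(\lambda+\frac{j+n-\nu}{2}\right)_{\nu+1}}$$ when $n+\nu-j$ is even and $\widetilde\varpi_{j,\nu}^{m,n}(\lambda)=0$ otherwise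 (with $\widetilde\varpi_{j,\nu}^{n,m}$ obtained by interchanging $m$ and $n$ throughout, including in the parity condition), and $$\widetilde d_{\nu,j,n}^{\,m}(\lambda)=\frac{2(-1)^{m+\nu+n+1}(j+\lambda)(2\lambda+2\nu-1)(2\lambda)_m\,(j+2\lambda+\nu+1)_{-j+n-2}}{m!\,(\nu-j)!\,(-\nu+n+1)!}\;{}_4F_3\!\left({1,\ -m,\ m+2\lambda,\ \lambda+\nu+\frac12\atop\lambda+\frac12,\ -j+\nu+1,\ j+2\lambda+\nu+1};1\right).$$
   Context: $(z)_0=1$, $(z)_N=\prod_{\sigma=0}^{N-1}(z+\sigma)$ for $N\ge1$, and for negative integer index $(z)_{N}=\Gamma(z+N)/\Gamma(z)$. The generalized hypergeometric series is ${}_pF_q\left({a_1,\ldots,a_p\atop b_1,\ldots,b_q};x\right)=\sum_{N\ge0}\frac{(a_1)_N\cdots(a_p)_N}{(b_1)_N\cdots(b_q)_N}\frac{x^N}{N!}$. Gegenbauer polynomials are $C_n^{(\lambda)}(x)=\frac{(2\lambda)_n}{(\lambda+\frac12)_n}P_n^{(\lambda-\frac12,\lambda-\frac12)}(x)$ for $n\ge0$, where $P_n^{(\alpha,\beta)}(x)=\frac{(\alpha+1)_n}{n!}\,{}_2F_1\left({-n,\ n+\alpha+\beta+1\atop\alpha+1};\frac{1-x}{2}\right)$ are the Jacobi polynomials. Empty sums are zero. *)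

(* Defs.v *)
From Stdlib Require Import Reals ZArith List.
From Coquelicot Require Import Coquelicot.
Import ListNotations.
Open Scope R_scope.

Fixpoint rising (z : R) (N : nat) : R :=
  match N with
  | O => 1
  | S k => rising z k * (z + INR k)
  end.

(* Euler's limit k! k^z / (z (z+1) ... (z+k)), which gives the Gamma function
   at every real z other than 0, -1, -2, ... (where the value is junk). *)
Definition Gamma (z : R) : R :=
  real (Lim_seq (fun k => INR (fact k) * Rpower (INR k) z / rising z (S k))).

Definition poch (z : R) (N : Z) : R :=
  if (0 <=? N)%Z then rising z (Z.to_nat N)
  else Gamma (z + IZR N) / Gamma z.

Definition poch_list (a : list R) (N : nat) : R :=
  fold_right Rmult 1 (map (fun z => poch z (Z.of_nat N)) a).

Definition hypergeom (a b : list R) (x : R) : R :=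
  Series (fun N => poch_list a N / poch_list b N * (x ^ N / INR (fact N))).

Definition jacobi (alpha beta : R) (n : nat) (x : R) : R :=
  poch (alpha + 1) (Z.of_nat n) / INR (fact n) *
  hypergeom [- INR n; INR n + alpha + beta + 1] [alpha + 1] ((1 - x) / 2).

Definition gegenbauer (lambda : R) (n : nat) (x : R) : R :=
  poch (2 * lambda) (Z.of_nat n) / poch (lambda + 1 / 2) (Z.of_nat n) *
  jacobi (lambda - 1 / 2) (lambda - 1 / 2) n x.

(* Both sides are polynomials in x; RInt is the oriented integral, so x + 1
   may lie on either side of -1. *)
Definition convolution_expansion (lambda : R) (m n : nat) (rho : nat -> R)
  : Prop :=
  forall x : R,
    RInt (fun t => gegenbauer lambda m (x - t) * gegenbauer lambda n t)
      (-1) (x + 1)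
    = sum_n_m (fun j => rho j * gegenbauer lambda j (x + 1)) 0 (m + n + 1).

(* The natural-number subtraction is exact for nu <= m + 1, and Z.to_nat of the
   half is exact for j <= n + nu; both hold wherever the term is summed. *)
Definition varpi (lambda : R) (m n j nu : nat) : R :=
  let h := ((Z.of_nat n + Z.of_nat nu - Z.of_nat j) / 2)%Z in
  if Z.even (Z.of_nat n + Z.of_nat nu - Z.of_nat j) then
    ((INR j + lambda) * (-1) ^ (m + nu + 1)
     * poch lambda (Z.of_nat nu - 1)
     * poch (2 * lambda + 2 * INR nu - 2) (Z.of_nat m - Z.of_nat nu + 1)
     * poch (- INR nu) h)
    / (2 * INR (fact (m + 1 - nu)) * INR (fact (Z.to_nat h))
       * poch (lambda + (INR j + INR n - INR nu) / 2) (Z.of_nat nu + 1))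
  else 0.

(* Summed only for j < nu <= n + 1, where both subtractions are exact. *)
Definition dcoef (lambda : R) (m n j nu : nat) : R :=
  (2 * (-1) ^ (m + nu + n + 1) * (INR j + lambda)
   * (2 * lambda + 2 * INR nu - 1)
   * poch (2 * lambda) (Z.of_nat m)
   * poch (INR j + 2 * lambda + INR nu + 1) (- Z.of_nat j + Z.of_nat n - 2))
  / (INR (fact m) * INR (fact (nu - j)) * INR (fact (n + 1 - nu)))
  * hypergeom
      [1; - INR m; INR m + 2 * lambda; lambda + INR nu + 1 / 2]
      [lambda + 1 / 2; - INR j + INR nu + 1; INR j + 2 * lambda + INR nu + 1]
      1.

(* Main.v *)
(* Put u = 1 + x.  The three-term recurrence, read off the hypergeometric series
   at 1, gives the parity of C_n, hence its Taylor expansion at -1; the same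
   recurrence expands u^N / N! in the C_j by induction on N.  As the convolution
   of u^i / i! and u^k / k! is u^(i+k+1) / (i+k+1)!, the coefficient of C_j in the
   convolution is
     sum_(nu = 1)^(m+1) C_m^(nu-1)(-1) * [C_j] (nu-fold integral of C_n from -1),
   and m, n may be exchanged here.  For nu <= j the constants of integration do
   not reach C_j, so 2 (j + lambda) int C_j = C_(j+1) - C_(j-1) + const gives the
   inner coefficient in closed form (varpi) by induction on nu; for nu > j it is
   the 4F3 of dcoef term by term. *)

Require Import Defs.
From Stdlib Require Import Reals ZArith List Lra Lia.
From Coquelicot Require Import Coquelicot.
Open Scope R_scope.

(** * Rising factorials and truncated reciprocal factorials *)

Lemma rising_add (z : R) (a b : nat) :
  rising z (a + b) = rising z a * rising (z + INR a) b.
Proof.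
  induction b as [|b IH].
  - rewrite Nat.add_0_r; simpl; ring.
  - rewrite Nat.add_succ_r; cbn [rising]; rewrite IH, plus_INR; ring.
Qed.

Lemma rising_pos (z : R) (k : nat) : 0 < z -> 0 < rising z k.
Proof.
  intros Hz; induction k as [|k IH]; cbn [rising]; [lra|].
  apply Rmult_lt_0_compat; [exact IH|].
  pose proof (pos_INR k); lra.
Qed.

Lemma rising_S_left (z : R) (k : nat) : rising z (S k) = z * rising (z + 1) k.
Proof.
  change (S k) with (1 + k)%nat; rewrite rising_add; cbn [rising INR]; ring.
Qed.

Lemma rising_duplication (z : R) (k : nat) :
  rising (2 * z) (2 * k) = 4 ^ k * rising z k * rising (z + 1 / 2) k.
Proof.
  induction k as [|k IH]; [cbn; ring|].
  replace (2 * S k)%nat with (S (S (2 * k))) by lia.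
  cbn [rising pow]; rewrite IH, S_INR, mult_INR; cbn [INR]; field.
Qed.

(** This is 1 / Gamma(n - k + 1) at integers: the zero value past k = n lets coefficient identities
    hold for every k, with no case split at the degree. *)
Definition inv_fact_diff (n k : nat) : R :=
  if (k <=? n)%nat then / INR (fact (n - k)) else 0.

Lemma inv_fact_diff_le (n k : nat) :
  (k <= n)%nat -> inv_fact_diff n k = / INR (fact (n - k)).
Proof. intros H; unfold inv_fact_diff; now apply Nat.leb_le in H as ->. Qed.

Lemma inv_fact_diff_gt (n k : nat) : (n < k)%nat -> inv_fact_diff n k = 0.
Proof. intros H; unfold inv_fact_diff; now apply Nat.leb_gt in H as ->. Qed.

Lemma inv_fact_diff_SS (n k : nat) :
  inv_fact_diff (S n) (S k) = inv_fact_diff n k.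
Proof. reflexivity. Qed.

Lemma INR_fact_S (n : nat) : INR (fact (S n)) = (INR n + 1) * INR (fact n).
Proof. rewrite fact_simpl, mult_INR, S_INR; reflexivity. Qed.

(** At the edge k = n + 1 the linear factor vanishes exactly where the left side is cut off.
    Shifting all occurrences to one common pair of indices in this way leaves rational identities
    for [field]. *)
Lemma inv_fact_diff_pred (n k : nat) :
  inv_fact_diff n k = (INR n + 1 - INR k) * inv_fact_diff (S n) k.
Proof.
  destruct (le_lt_dec k n) as [H|H].
  - rewrite !inv_fact_diff_le by lia.
    replace (S n - k)%nat with (S (n - k)) by lia.
    rewrite INR_fact_S, minus_INR by lia.
    pose proof (INR_fact_neq_0 (n - k)).
    assert (INR k <= INR n) by (apply le_INR; lia).
    field; split; lra.
  - rewrite inv_fact_diff_gt by lia.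
    destruct (Nat.eq_dec k (S n)) as [->|Hk].
    + rewrite S_INR; ring.
    + rewrite inv_fact_diff_gt by lia; ring.
Qed.

Lemma rising_opp_INR (n k : nat) :
  rising (- INR n) k = (-1) ^ k * INR (fact n) * inv_fact_diff n k.
Proof.
  induction k as [|k IH].
  - rewrite inv_fact_diff_le, Nat.sub_0_r by lia; cbn.
    field; apply INR_fact_neq_0.
  - cbn [rising pow]; rewrite IH.
    rewrite <- (inv_fact_diff_SS n k), (inv_fact_diff_pred n (S k)), S_INR; ring.
Qed.

Lemma poch_of_nat (z : R) (N : nat) : poch z (Z.of_nat N) = rising z N.
Proof.
  unfold poch; replace (0 <=? Z.of_nat N)%Z with true
    by (symmetry; apply Z.leb_le; lia).
  now rewrite Nat2Z.id.
Qed.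

(** * Gegenbauer polynomials: expansions at 1 and -1, recurrence, parity *)

Lemma Series_finite (a : nat -> R) (N : nat) :
  (forall k, (N < k)%nat -> a k = 0) -> Series a = sum_f_R0 a N.
Proof.
  intros Ha; apply is_series_unique.
  change (is_lim_seq (sum_n a) (sum_f_R0 a N)).
  apply (is_lim_seq_ext_loc (fun _ => sum_f_R0 a N)).
  - exists N; intros n Hn; rewrite sum_n_Reals.
    induction Hn as [|n Hn IH]; [reflexivity|].
    cbn [sum_f_R0]; rewrite <- IH, Ha by lia; ring.
  - apply is_lim_seq_const.
Qed.

(* taylor_coef lambda n k is the k-th derivative of C_n^(lambda) at -1. *)
Definition taylor_coef (l : R) (n k : nat) : R :=
  (-1) ^ (n + k) * rising (2 * l) (n + k) * inv_fact_diff n k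
  / (2 ^ k * rising (l + 1 / 2) k).

Lemma pow_opp1_sqr (n : nat) : (-1) ^ n * (-1) ^ n = 1.
Proof. rewrite <- Rpow_mult_distr; replace (-1 * -1) with 1 by ring; apply pow1. Qed.

Lemma taylor_coef_gt (l : R) (n k : nat) : (n < k)%nat -> taylor_coef l n k = 0.
Proof.
  intros H; unfold taylor_coef; rewrite inv_fact_diff_gt by lia.
  unfold Rdiv; ring.
Qed.

Lemma sum_f_R0_extend (f : nat -> R) (N M : nat) :
  (N <= M)%nat -> (forall k, (N < k)%nat -> f k = 0) ->
  sum_f_R0 f M = sum_f_R0 f N.
Proof.
  intros H Hf; induction H as [|M H IH]; [reflexivity|].
  cbn [sum_f_R0]; rewrite IH, Hf by lia; ring.
Qed.

(** The factor (lambda + 1/2)_n of the normalisation cancels against the Jacobi prefactor, and (2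
    lambda)_n (2 lambda + n)_k merges into (2 lambda)_(n+k). The free bound M pads with zeros, so
    that polynomials of different degrees can be compared over one range. *)
Lemma gegenbauer_at_one (l : R) (n M : nat) (x : R) :
  - (1 / 2) < l -> (n <= M)%nat ->
  gegenbauer l n x
  = sum_f_R0 (fun k => (-1) ^ n * taylor_coef l n k * (1 - x) ^ k / INR (fact k)) M.
Proof.
  intros Hl HM.
  rewrite (sum_f_R0_extend _ n) by
    (auto; intros k Hk; rewrite taylor_coef_gt by lia; unfold Rdiv; ring).
  unfold gegenbauer, jacobi, hypergeom.
  rewrite (Series_finite _ n).
  - rewrite <- Rmult_assoc, scal_sum; apply sum_eq; intros k Hk.
    unfold poch_list; cbn [map fold_right]; rewrite !poch_of_nat.
    replace (l - 1 / 2 + 1) with (l + 1 / 2) by field.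
    replace (INR n + (l - 1 / 2) + (l - 1 / 2) + 1) with (2 * l + INR n) by field.
    rewrite rising_opp_INR; unfold taylor_coef.
    rewrite rising_add, pow_add.
    replace ((1 - x) / 2) with ((1 - x) * / 2) by reflexivity.
    rewrite Rpow_mult_distr, pow_inv.
    assert (0 < rising (l + 1 / 2) n) by (apply rising_pos; lra).
    assert (0 < rising (l + 1 / 2) k) by (apply rising_pos; lra).
    pose proof (INR_fact_neq_0 n); pose proof (INR_fact_neq_0 k).
    pose proof (pow_nonzero 2 k).
    transitivity (((-1) ^ n * (-1) ^ n) * ((-1) ^ k * rising (2 * l) n
      * rising (2 * l + INR n) k * inv_fact_diff n k * (1 - x) ^ k
      / (2 ^ k * rising (l + 1 / 2) k * INR (fact k)))).
    + rewrite pow_opp1_sqr; field; repeat split; lra.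
    + field; repeat split; lra.
  - intros k Hk; unfold poch_list; cbn [map fold_right]; rewrite poch_of_nat.
    rewrite rising_opp_INR, inv_fact_diff_gt by lia; unfold Rdiv; ring.
Qed.

Lemma gegenbauer_0 (l x : R) : - (1 / 2) < l -> gegenbauer l 0 x = 1.
Proof.
  intros Hl; rewrite (gegenbauer_at_one l 0 0) by (auto; lia).
  unfold taylor_coef; cbn [sum_f_R0]; rewrite inv_fact_diff_le by lia; cbn; field.
Qed.

Lemma gegenbauer_1 (l x : R) : - (1 / 2) < l -> gegenbauer l 1 x = 2 * l * x.
Proof.
  intros Hl; rewrite (gegenbauer_at_one l 1 1) by (auto; lia).
  unfold taylor_coef; cbn [sum_f_R0]; rewrite !inv_fact_diff_le by lia; cbn.
  field; lra.
Qed.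

(** Comparison of the coefficients of (1 - x)^k: writing x = 1 - (1 - x) turns multiplication by x
    into a difference with an index shift. [E0] is the constant term, [ES] all the others. *)
Lemma gegenbauer_rec (l : R) (p : nat) (x : R) :
  - (1 / 2) < l ->
  (INR p + 2) * gegenbauer l (S (S p)) x
  = 2 * (INR p + 1 + l) * x * gegenbauer l (S p) x
    - (INR p + 2 * l) * gegenbauer l p x.
Proof.
  intros Hl.
  set (e := fun n k => (-1) ^ n * taylor_coef l n k / INR (fact k)).
  assert (E : forall n M, (n <= M)%nat ->
    gegenbauer l n x = sum_f_R0 (fun k => e n k * (1 - x) ^ k) M).
  { intros n M H; rewrite (gegenbauer_at_one l n M) by auto.
    apply sum_eq; intros k _; unfold e, Rdiv; ring. }
  assert (E0 : (INR p + 2) * e (S (S p)) 0%nat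
    = 2 * (INR p + 1 + l) * e (S p) 0%nat - (INR p + 2 * l) * e p 0%nat).
  { unfold e, taylor_coef; rewrite !Nat.add_0_r.
    rewrite (inv_fact_diff_pred p), (inv_fact_diff_pred (S p)).
    cbn [rising pow fact]; rewrite ?S_INR; change (INR 0) with 0.
    field. }
  assert (ES : forall k, (INR p + 2) * e (S (S p)) (S k)
    = 2 * (INR p + 1 + l) * (e (S p) (S k) - e (S p) k)
      - (INR p + 2 * l) * e p (S k)).
  { intros k; unfold e, taylor_coef.
    rewrite <- (inv_fact_diff_SS (S p) k).
    rewrite (inv_fact_diff_pred p), (inv_fact_diff_pred (S p)).
    rewrite !Nat.add_succ_r, !Nat.add_succ_l.
    rewrite INR_fact_S.
    cbn [rising pow]; rewrite ?S_INR, plus_INR.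
    assert (0 < rising (l + 1 / 2) k) by (apply rising_pos; lra).
    pose proof (INR_fact_neq_0 k); pose proof (pow_nonzero 2 k).
    pose proof (pos_INR k).
    field; repeat split; lra. }
  (* Kept opaque so that the distributivity rewrites below act only on the sums. *)
  remember (2 * (INR p + 1 + l)) as A eqn:HA.
  remember (INR p + 2 * l) as B eqn:HB.
  rewrite (E (S (S p)) (S (S p))), (E p (S (S p))) by lia.
  replace (A * x * gegenbauer l (S p) x) with
    (A * gegenbauer l (S p) x - A * (1 - x) * gegenbauer l (S p) x) by ring.
  (* The copy multiplied by 1 - x is expanded one degree lower: once the constant terms of the other
     sums are split off, all ranges agree. *)
  rewrite (E (S p) (S (S p))) at 1 by lia.
  rewrite (E (S p) (S p)) by lia.
  rewrite !(decomp_sum _ (S (S p))) by lia; cbn [pred].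
  rewrite !Rmult_plus_distr_l, <- !Rmult_assoc, E0, !scal_sum.
  assert (K : sum_f_R0 (fun i => e (S (S p)) (S i) * (1 - x) ^ S i * (INR p + 2)) (S p)
    = sum_f_R0 (fun i => e (S p) (S i) * (1 - x) ^ S i * A) (S p)
     - sum_f_R0 (fun k => e (S p) k * (1 - x) ^ k * (A * (1 - x))) (S p)
     - sum_f_R0 (fun i => e p (S i) * (1 - x) ^ S i * B) (S p)).
  { rewrite <- !minus_sum; apply sum_eq; intros k _; cbn [pow].
    transitivity ((INR p + 2) * e (S (S p)) (S k) * ((1 - x) * (1 - x) ^ k)); [ring|].
    rewrite ES; ring. }
  rewrite K; ring.
Qed.

Lemma gegenbauer_opp (l : R) (n : nat) (x : R) :
  - (1 / 2) < l -> gegenbauer l n (- x) = (-1) ^ n * gegenbauer l n x.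
Proof.
  intros Hl.
  (* The recurrence has order two, so the induction carries two consecutive indices. *)
  enough (H : gegenbauer l n (- x) = (-1) ^ n * gegenbauer l n x
    /\ gegenbauer l (S n) (- x) = (-1) ^ S n * gegenbauer l (S n) x) by apply H.
  induction n as [|n [IH1 IH2]].
  - rewrite !gegenbauer_0, !gegenbauer_1 by auto; cbn; split; ring.
  - split; [exact IH2|].
    apply (Rmult_eq_reg_l (INR n + 2)); [|pose proof (pos_INR n); lra].
    rewrite gegenbauer_rec, IH1, IH2 by auto.
    transitivity ((-1) ^ n * ((INR n + 2) * gegenbauer l (S (S n)) x)); [|cbn; ring].
    rewrite gegenbauer_rec by auto; cbn; ring.
Qed.

Lemma gegenbauer_taylor (l : R) (n M : nat) (x : R) :
  - (1 / 2) < l -> (n <= M)%nat ->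
  gegenbauer l n x
  = sum_f_R0 (fun k => taylor_coef l n k * ((x + 1) ^ k / INR (fact k))) M.
Proof.
  intros Hl HM.
  replace x with (- - x) at 1 by ring.
  rewrite gegenbauer_opp, (gegenbauer_at_one l n M), scal_sum by auto.
  apply sum_eq; intros k _.
  replace (1 - - x) with (x + 1) by ring.
  transitivity ((-1) ^ n * (-1) ^ n * (taylor_coef l n k * ((x + 1) ^ k / INR (fact k))));
    [unfold Rdiv|rewrite pow_opp1_sqr]; ring.
Qed.

(** * Powers of 1 + x in the Gegenbauer basis *)

Lemma inv_fact_diff_succ (n k : nat) :
  inv_fact_diff n (S k) = (INR n - INR k) * inv_fact_diff n k.
Proof. rewrite inv_fact_diff_pred, inv_fact_diff_SS, S_INR; ring. Qed.

(* (1 + x)^N / N! = sum_j (j + lambda) / lambda * power_coef lambda N j * C_j(x). *)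
Definition power_coef (l : R) (N j : nat) : R :=
  2 ^ N * rising (l + 1 / 2) N * inv_fact_diff N j / rising (2 * l + 1) (N + j).

Lemma power_coef_gt (l : R) (N j : nat) : (N < j)%nat -> power_coef l N j = 0.
Proof.
  intros H; unfold power_coef; rewrite inv_fact_diff_gt by lia.
  unfold Rdiv; ring.
Qed.

(** This is what multiplying (1 + x)^N / N! by 1 + x does to the coefficient of C_j. At j = 0 the
    value of [pred] is harmless, its term carrying the factor [INR j]. *)
Lemma power_coef_mul (l : R) (N j : nat) :
  - (1 / 2) < l ->
  2 * (INR N + 1) * (INR j + l) * power_coef l (S N) j
  = 2 * (INR j + l) * power_coef l N j + INR j * power_coef l N (pred j)
    + (INR j + 2 * l) * power_coef l N (S j).
Proof.
  intros Hl; unfold power_coef; destruct j as [|i]; cbn [pred].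
  - rewrite !Nat.add_succ_r, !Nat.add_0_r, (inv_fact_diff_succ N 0).
    rewrite (inv_fact_diff_pred N 0).
    cbn [rising pow Nat.add]; change (INR 0) with 0.
    assert (0 < rising (2 * l + 1) N) by (apply rising_pos; lra).
    pose proof (pos_INR N).
    field; split; lra.
  - rewrite (inv_fact_diff_succ N (S i)), (inv_fact_diff_succ N i).
    rewrite inv_fact_diff_SS.
    rewrite !Nat.add_succ_r, !Nat.add_succ_l.
    cbn [rising pow]; rewrite !S_INR, plus_INR.
    assert (0 < rising (2 * l + 1) (N + i)) by (apply rising_pos; lra).
    pose proof (pos_INR N); pose proof (pos_INR i).
    field; repeat split; lra.
Qed.

(** Coefficient form of integrating (1 + x)^N / N! through 2 (j + lambda) int C_j = C_(j+1) -
    C_(j-1) + const. Only indices j = i + 1 >= 1 are covered, because the constant of integration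
    enters C_0. *)
Lemma power_coef_int (l : R) (N i : nat) :
  - (1 / 2) < l ->
  2 * (INR i + 1 + l) * power_coef l (S N) (S i)
  = power_coef l N i - power_coef l N (S (S i)).
Proof.
  intros Hl; unfold power_coef.
  rewrite (inv_fact_diff_succ N (S i)), (inv_fact_diff_succ N i).
  rewrite inv_fact_diff_SS.
  rewrite !Nat.add_succ_r, !Nat.add_succ_l.
  cbn [rising pow]; rewrite !S_INR, plus_INR.
  assert (0 < rising (2 * l + 1) (N + i)) by (apply rising_pos; lra).
  pose proof (pos_INR N); pose proof (pos_INR i).
  field; repeat split; lra.
Qed.

(** The three-term recurrence summed against weights b; the last two terms are what the reindexing
    leaves at the upper end. *)
Lemma gegenbauer_mul_sum (l x : R) (b : nat -> R) (M : nat) :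
  - (1 / 2) < l ->
  sum_f_R0 (fun j => 2 * (INR j + l) * b j * x * gegenbauer l j x) M
  = sum_f_R0 (fun j => (INR j * b (pred j) + (INR j + 2 * l) * b (S j))
                       * gegenbauer l j x) M
    + b M * (INR M + 1) * gegenbauer l (S M) x
    - (INR M + 2 * l) * b (S M) * gegenbauer l M x.
Proof.
  intros Hl; induction M as [|M IH].
  - cbn; rewrite gegenbauer_0, gegenbauer_1 by auto; ring.
  - cbn [sum_f_R0]; rewrite IH; cbn [pred]; rewrite S_INR.
    pose proof (gegenbauer_rec l M x Hl) as H.
    replace (b (S M) * (INR M + 1 + 1) * gegenbauer l (S (S M)) x)
      with (b (S M) * ((INR M + 2) * gegenbauer l (S (S M)) x)) by ring.
    rewrite H; ring.
Qed.

Lemma power_expansion (l x : R) (N M : nat) :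
  - (1 / 2) < l -> l <> 0 -> (N <= M)%nat ->
  (x + 1) ^ N / INR (fact N)
  = sum_f_R0 (fun j => (INR j + l) / l * power_coef l N j * gegenbauer l j x) M.
Proof.
  intros Hl Hl0; revert M; induction N as [|N IH]; intros M HM.
  - rewrite (sum_f_R0_extend _ 0) by
      (auto; intros k Hk; rewrite power_coef_gt by lia; ring).
    cbn [sum_f_R0]; rewrite gegenbauer_0 by auto.
    unfold power_coef; rewrite inv_fact_diff_le by lia; cbn; field; auto.
  - pose proof (pos_INR N).
    rewrite INR_fact_S.
    apply (Rmult_eq_reg_l (2 * l * (INR N + 1)));
      [|repeat apply Rmult_integral_contrapositive_currified; lra].
    transitivity (2 * l * (x + 1) * ((x + 1) ^ N / INR (fact N))).
    { cbn [pow]; field; split; [apply INR_fact_neq_0|lra]. }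
    rewrite (IH M) by lia.
    transitivity (sum_f_R0 (fun j => 2 * (INR j + l) * power_coef l N j * x * gegenbauer l j x) M
      + sum_f_R0 (fun j => 2 * (INR j + l) * power_coef l N j * gegenbauer l j x) M).
    { rewrite <- plus_sum, scal_sum; apply sum_eq; intros j _; field; auto. }
    rewrite gegenbauer_mul_sum by auto.
    (* Since N < M, both boundary terms vanish. *)
    rewrite (power_coef_gt l N M), (power_coef_gt l N (S M)) by lia.
    rewrite !Rmult_0_l, Rmult_0_r, Rmult_0_l, Rplus_0_r, Rminus_0_r.
    rewrite <- plus_sum, scal_sum; apply sum_eq; intros j _.
    transitivity ((2 * (INR N + 1) * (INR j + l) * power_coef l (S N) j) * gegenbauer l j x);
      [rewrite power_coef_mul by auto; ring|field; auto].
Qed.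

(** * Linear independence of the Gegenbauer polynomials *)

Lemma polynomial_coef_zero (a : nat -> R) (N : nat) :
  (forall u, sum_f_R0 (fun k => a k * u ^ k) N = 0) ->
  forall k, (k <= N)%nat -> a k = 0.
Proof.
  revert a; induction N as [|N IH]; intros a Ha k Hk.
  - specialize (Ha 0); cbn in Ha; replace k with 0%nat by lia; lra.
  - (* P(2u) - 2^(N+1) P(u) has degree at most N. *)
    assert (L : forall i, (i <= N)%nat -> a i = 0).
    { intros i Hi.
      assert (H : a i * (2 ^ i - 2 ^ S N) = 0).
      { apply (IH (fun i => a i * (2 ^ i - 2 ^ S N))); [|exact Hi].
        intros u.
        transitivity (sum_f_R0 (fun k => a k * (2 * u) ^ k) (S N)
          - 2 ^ S N * sum_f_R0 (fun k => a k * u ^ k) (S N)).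
        - rewrite scal_sum, <- minus_sum; cbn [sum_f_R0].
          rewrite Rpow_mult_distr.
          match goal with |- ?p = ?q + ?r => replace r with 0 by ring end.
          rewrite Rplus_0_r; apply sum_eq; intros j _.
          rewrite Rpow_mult_distr; ring.
        - rewrite !Ha; ring. }
      apply Rmult_integral in H as [H|H]; [exact H|].
      assert (2 ^ i < 2 ^ S N) by (apply Rlt_pow; [lra|lia]); lra. }
    destruct (Nat.eq_dec k (S N)) as [->|Hne]; [|apply L; lia].
    specialize (Ha 1); cbn [sum_f_R0] in Ha.
    rewrite (sum_eq _ (fun _ => 0)) in Ha by (intros i Hi; rewrite L by lia; ring).
    rewrite sum_cte, pow1 in Ha; lra.
Qed.

Lemma sum_f_R0_switch (f : nat -> nat -> R) (N M : nat) :
  sum_f_R0 (fun i => sum_f_R0 (f i) M) N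
  = sum_f_R0 (fun j => sum_f_R0 (fun i => f i j) N) M.
Proof.
  induction N as [|N IH]; [reflexivity|].
  cbn [sum_f_R0]; rewrite IH, <- plus_sum; reflexivity.
Qed.

(** In (2 lambda)_(2n) every factor after the first is positive, so only 2 lambda could vanish. *)
Lemma taylor_coef_diag_neq_0 (l : R) (n : nat) :
  - (1 / 2) < l -> l <> 0 -> taylor_coef l n n <> 0.
Proof.
  intros Hl Hl0; unfold taylor_coef; rewrite inv_fact_diff_le, Nat.sub_diag by lia.
  assert (rising (2 * l) (n + n) <> 0).
  { destruct (n + n)%nat as [|k]; [cbn; lra|]; rewrite rising_S_left.
    assert (0 < rising (2 * l + 1) k) by (apply rising_pos; lra).
    apply Rmult_integral_contrapositive_currified; lra. }
  assert (0 < rising (l + 1 / 2) n) by (apply rising_pos; lra).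
  assert (0 < 2 ^ n) by (apply pow_lt; lra).
  assert ((-1) ^ (n + n) <> 0) by (apply pow_nonzero; lra).
  cbn [fact INR]; unfold Rdiv; rewrite Rinv_1, Rmult_1_r.
  apply Rmult_integral_contrapositive_currified;
    [apply Rmult_integral_contrapositive_currified; assumption|].
  apply Rinv_neq_0_compat, Rmult_integral_contrapositive_currified; lra.
Qed.

(** Among the terms, only the one of top index reaches the top power of x + 1, and it does so with a
    nonzero coefficient; induction removes the rest. *)
Lemma gegenbauer_independent (l : R) (c : nat -> R) (N : nat) :
  - (1 / 2) < l -> l <> 0 ->
  (forall x, sum_f_R0 (fun j => c j * gegenbauer l j x) N = 0) ->
  forall j, (j <= N)%nat -> c j = 0.
Proof.
  intros Hl Hl0; induction N as [|N IH]; intros Hc j Hj.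
  - specialize (Hc 0); cbn in Hc; rewrite gegenbauer_0 in Hc by auto.
    replace j with 0%nat by lia; lra.
  - assert (Top : c (S N) = 0).
    { assert (H : sum_f_R0 (fun j => c j * taylor_coef l j (S N)) (S N) / INR (fact (S N)) = 0).
      { apply (polynomial_coef_zero (fun k =>
          sum_f_R0 (fun j => c j * taylor_coef l j k) (S N) / INR (fact k)) (S N)); [|lia].
        intros u; rewrite <- (Hc (u - 1)).
        transitivity (sum_f_R0 (fun k => sum_f_R0 (fun j =>
          c j * taylor_coef l j k * (u ^ k / INR (fact k))) (S N)) (S N)).
        - apply sum_eq; intros k _; rewrite <- scal_sum; unfold Rdiv; ring.
        - rewrite sum_f_R0_switch; apply sum_eq; intros i Hi.
          rewrite (gegenbauer_taylor l i (S N)), scal_sum by auto.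
          apply sum_eq; intros k _.
          replace (u - 1 + 1) with u by ring; ring. }
      cbn [sum_f_R0] in H.
      rewrite (sum_eq _ (fun _ => 0)) in H by
        (intros i Hi; rewrite taylor_coef_gt by lia; ring).
      rewrite sum_cte, Rmult_0_l, Rplus_0_l in H.
      apply Rmult_integral in H as [H|H].
      - apply Rmult_integral in H as [H|H]; [exact H|].
        now apply taylor_coef_diag_neq_0 in H.
      - exfalso; revert H; apply Rinv_neq_0_compat, INR_fact_neq_0. }
    destruct (Nat.eq_dec j (S N)) as [->|Hne]; [exact Top|].
    apply IH; [|lia].
    intros x; rewrite <- (Hc x); cbn [sum_f_R0]; rewrite Top; ring.
Qed.

(** * Coefficients of iterated integrals of C_n *)

(* (j + lambda) / lambda * antideriv_coef lambda n nu j is the coefficient of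
   C_j in the nu-fold iterated integral of C_n from -1. *)
Definition antideriv_coef (l : R) (n nu j : nat) : R :=
  sum_f_R0 (fun i => taylor_coef l n i * power_coef l (i + nu) j) n.

Lemma antideriv_coef_gt (l : R) (n nu j : nat) :
  (n + nu < j)%nat -> antideriv_coef l n nu j = 0.
Proof.
  intros H; unfold antideriv_coef.
  rewrite (sum_eq _ (fun _ => 0)), sum_cte; [ring|].
  intros i Hi; rewrite power_coef_gt by lia; ring.
Qed.

(** Substituting the power expansions into the Taylor expansion of C_n returns C_n itself;
    independence then forces a Kronecker delta, divided by the normalising factor (n + lambda) /
    lambda. *)
Lemma antideriv_coef_0 (l : R) (n j : nat) :
  - (1 / 2) < l -> l <> 0 ->
  antideriv_coef l n 0 j = if Nat.eqb j n then l / (INR n + l) else 0.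
Proof.
  intros Hl Hl0.
  assert (P : forall k, INR k + l <> 0).
  { intros [|k]; [cbn; lra|rewrite S_INR; pose proof (pos_INR k); lra]. }
  destruct (le_lt_dec j n) as [Hj|Hj].
  2:{ rewrite antideriv_coef_gt by lia.
      now replace (Nat.eqb j n) with false by (symmetry; apply Nat.eqb_neq; lia). }
  set (c := fun j => (INR j + l) / l * antideriv_coef l n 0 j
                     - if Nat.eqb j n then 1 else 0).
  assert (H : c j = 0).
  { apply (gegenbauer_independent l c n Hl Hl0); [|exact Hj].
    intros x.
    transitivity (sum_f_R0 (fun j => sum_f_R0 (fun i => taylor_coef l n i *
        ((INR j + l) / l * power_coef l i j * gegenbauer l j x)) n) n
      - sum_f_R0 (fun j => (if Nat.eqb j n then 1 else 0) * gegenbauer l j x) n).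
    - rewrite <- minus_sum; apply sum_eq; intros k _; unfold c.
      rewrite Rmult_minus_distr_r; f_equal.
      rewrite Rmult_assoc, (Rmult_comm (antideriv_coef _ _ _ _)), <- Rmult_assoc.
      unfold antideriv_coef; rewrite scal_sum; apply sum_eq; intros i _.
      rewrite Nat.add_0_r; ring.
    - rewrite sum_f_R0_switch.
      apply Rminus_diag_eq; transitivity (gegenbauer l n x).
      + rewrite (gegenbauer_taylor l n n) by auto.
        apply sum_eq; intros i Hi.
        rewrite (power_expansion l x i n), scal_sum by auto.
        apply sum_eq; intros; ring.
      + destruct n as [|n]; [cbn; ring|].
        cbn [sum_f_R0].
        rewrite (sum_eq _ (fun _ => 0)), sum_cte, Nat.eqb_refl; [ring|].
        intros i Hi; replace (Nat.eqb i (S n)) with false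
          by (symmetry; apply Nat.eqb_neq; lia); ring. }
  unfold c in H; destruct (Nat.eqb j n) eqn:E.
  - apply Nat.eqb_eq in E as ->.
    specialize (P n).
    apply (Rmult_eq_reg_l ((INR n + l) / l)).
    + transitivity 1; [lra|field; auto].
    + apply Rmult_integral_contrapositive_currified; [auto|now apply Rinv_neq_0_compat].
  - rewrite Rminus_0_r in H; apply Rmult_integral in H as [H|H]; [|exact H].
    exfalso; revert H; apply Rmult_integral_contrapositive_currified;
      [auto|now apply Rinv_neq_0_compat].
Qed.

Lemma antideriv_coef_rec (l : R) (n nu i : nat) :
  - (1 / 2) < l ->
  2 * (INR i + 1 + l) * antideriv_coef l n (S nu) (S i)
  = antideriv_coef l n nu i - antideriv_coef l n nu (S (S i)).
Proof.
  intros Hl; unfold antideriv_coef; rewrite scal_sum, <- minus_sum.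
  apply sum_eq; intros k _.
  rewrite <- Rmult_minus_distr_l, <- power_coef_int, Nat.add_succ_r by auto; ring.
Qed.

(** Each integration moves the index by +1 or -1, so only indices of the parity of n + nu are
    reached; nu <= j keeps the recursion away from C_0. *)
Lemma antideriv_coef_odd (l : R) (n nu j h : nat) :
  - (1 / 2) < l -> l <> 0 ->
  (nu <= j)%nat -> (n + nu = j + 2 * h + 1)%nat -> antideriv_coef l n nu j = 0.
Proof.
  intros Hl Hl0; revert j h; induction nu as [|nu IH]; intros j h Hj Hh.
  - rewrite antideriv_coef_0 by auto.
    now replace (Nat.eqb j n) with false by (symmetry; apply Nat.eqb_neq; lia).
  - destruct j as [|i]; [lia|].
    apply (Rmult_eq_reg_l (2 * (INR i + 1 + l))); [|pose proof (pos_INR i); lra].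
    rewrite antideriv_coef_rec, (IH i h) by (auto; lia).
    destruct h as [|h].
    + rewrite antideriv_coef_gt by lia; ring.
    + rewrite (IH (S (S i)) h) by lia; ring.
Qed.

(** The induction step of [antideriv_coef_even] with z = lambda + n and the factor lambda / 2^nu
    removed. Once the outer factors are split off, all three terms share (-nu)_h and (z - h)_nu. *)
Lemma antideriv_closed_form_rec (z : R) (nu h : nat) :
  z - INR (S h) <> 0 -> 0 < z - INR h ->
  (z + INR nu + 1 - 2 * INR (S h)) * rising (- INR (S nu)) (S h)
    / (INR (fact (S h)) * rising (z - INR (S h)) (S (S nu)))
  = rising (- INR nu) (S h) / (INR (fact (S h)) * rising (z - INR (S h)) (S nu))
    - rising (- INR nu) h / (INR (fact h) * rising (z - INR h) (S nu)).
Proof.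
  intros Hz Hz'.
  rewrite INR_fact_S, (rising_S_left (- INR (S nu))).
  rewrite !(rising_S_left (z - INR (S h))).
  replace (z - INR (S h) + 1) with (z - INR h) by (rewrite S_INR; ring).
  replace (- INR (S nu) + 1) with (- INR nu) by (rewrite S_INR; ring).
  rewrite !S_INR in *; cbn [rising].
  assert (0 < rising (z - INR h) nu) by (apply rising_pos; lra).
  pose proof (INR_fact_neq_0 h); pose proof (pos_INR h); pose proof (pos_INR nu).
  field; repeat split; lra.
Qed.

(** Here h counts the downward moves among the nu moves of the index from n to j, and (-nu)_h / h!
    is the signed binomial coefficient (-1)^h binom(nu, h). *)
Lemma antideriv_coef_even (l : R) (n nu j h : nat) :
  - (1 / 2) < l -> l <> 0 ->
  (nu <= j)%nat -> (n + nu = j + 2 * h)%nat ->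
  antideriv_coef l n nu j
  = l / 2 ^ nu * rising (- INR nu) h
    / (INR (fact h) * rising (l + (INR n - INR h)) (S nu)).
Proof.
  intros Hl Hl0; revert j h; induction nu as [|nu IH]; intros j h Hj Hh.
  - rewrite antideriv_coef_0 by auto.
    destruct h as [|h].
    + replace j with n by lia; rewrite Nat.eqb_refl; cbn.
      assert (INR n + l <> 0).
      { destruct n as [|k]; [cbn; lra|rewrite S_INR; pose proof (pos_INR k); lra]. }
      field; repeat split; lra.
    + replace (Nat.eqb j n) with false by (symmetry; apply Nat.eqb_neq; lia).
      rewrite rising_S_left; cbn [INR]; unfold Rdiv; ring.
  - destruct j as [|i]; [lia|].
    apply (Rmult_eq_reg_l (2 * (INR i + 1 + l))); [|pose proof (pos_INR i); lra].
    rewrite antideriv_coef_rec, (IH i h) by (auto; lia).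
    assert (Hi : INR i = INR n + INR nu - 2 * INR h).
    { apply (f_equal INR) in Hh; rewrite !plus_INR, !S_INR, mult_INR in Hh; cbn [INR] in Hh; lra. }
    (* A consequence of nu <= j. It gives n - h >= 1 unless n = h = 0, so lambda + n - h is positive
       or equal to lambda. *)
    assert (Hn : (2 * h <= n)%nat) by lia.
    assert (Hn' : 2 * INR h <= INR n).
    { apply le_INR in Hn; rewrite mult_INR in Hn; cbn [INR] in Hn; lra. }
    pose proof (pos_INR h) as Hh0; pose proof (pos_INR nu) as Hnu0.
    assert (HA : l + (INR n - INR h) <> 0).
    { destruct h as [|h]; [|rewrite S_INR in *; pose proof (pos_INR h); lra].
      cbn [INR] in *; destruct n as [|n]; [cbn in *; lra|].
      rewrite S_INR; pose proof (pos_INR n); lra. }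
    assert (P2 : 2 ^ nu <> 0) by (apply pow_nonzero; lra).
    destruct h as [|h].
    (* Only upward moves: the index i + 2 is beyond reach and its term drops out. *)
    + rewrite antideriv_coef_gt, Hi by lia.
      change (INR 0) with 0 in *; rewrite !Rminus_0_r in *.
      cbn [fact INR pow]; rewrite (rising_S_left _ (S nu)), rising_S_left.
      cbn [rising].
      assert (0 < rising (l + INR n + 1) nu).
      { apply rising_pos; pose proof (pos_INR n); lra. }
      field; pose proof (pos_INR n); repeat split; lra.
    + rewrite (IH (S (S i)) h) by lia.
      transitivity (l / 2 ^ nu * ((l + INR n + INR nu + 1 - 2 * INR (S h))
        * rising (- INR (S nu)) (S h)
        / (INR (fact (S h)) * rising (l + INR n - INR (S h)) (S (S nu))))).
      * rewrite antideriv_closed_form_rec by (rewrite ?S_INR in *; lra).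
        unfold Rminus, Rdiv; rewrite !Rplus_assoc; ring.
      * rewrite Hi; cbn [pow].
        replace (l + (INR n - INR (S h))) with (l + INR n - INR (S h)) by ring.
        unfold Rdiv; rewrite Rinv_mult; field; repeat split;
          [apply Rgt_not_eq, rising_pos|apply INR_fact_neq_0|exact P2].
        rewrite S_INR in *; pose proof (pos_INR h); lra.
Qed.

(** * The Gamma function on the positive reals and [poch] at negative index *)

Lemma ln_le_sub (x : R) : 0 < x -> ln x <= x - 1.
Proof.
  intros Hx; pose proof (exp_ineq1_le (ln x)) as H.
  rewrite exp_ln in H by auto; lra.
Qed.

Definition euler_seq (z : R) (k : nat) : R :=
  INR (fact k) * Rpower (INR k) z / rising z (S k).

Lemma euler_seq_pos (z : R) (k : nat) : 0 < z -> 0 < euler_seq z k.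
Proof.
  intros Hz; unfold euler_seq, Rpower.
  apply Rdiv_lt_0_compat; [|now apply rising_pos].
  apply Rmult_lt_0_compat; [apply INR_fact_lt_0|apply exp_pos].
Qed.

(** Indices start at 1, since [Rpower] at base 0 rests on the default value of [ln]. *)
Lemma ln_euler_seq_step (z : R) (k : nat) : 0 < z ->
  ln (euler_seq z (S (S k))) - ln (euler_seq z (S k))
  = z * ln ((INR k + 2) / (INR k + 1)) - ln ((z + INR k + 2) / (INR k + 2)).
Proof.
  intros Hz; pose proof (pos_INR k).
  rewrite !ln_div by lra.
  assert (P : forall i, 0 < euler_seq z i) by (intros; now apply euler_seq_pos).
  assert (E : euler_seq z (S (S k)) * Rpower (INR k + 1) z * (z + INR k + 2)
    = euler_seq z (S k) * Rpower (INR k + 2) z * (INR k + 2)).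
  { unfold euler_seq; rewrite (INR_fact_S (S k)).
    change (rising z (S (S (S k)))) with (rising z (S (S k)) * (z + INR (S (S k)))).
    rewrite !S_INR.
    replace (INR k + 1 + 1) with (INR k + 2) by ring.
    assert (0 < rising z (S (S k))) by now apply rising_pos.
    field; lra. }
  apply (f_equal ln) in E.
  assert (Q : forall a b, 0 < Rpower a b) by (intros; apply exp_pos).
  rewrite !ln_mult in E by
    (repeat first [apply P | apply Q | lra | apply Rmult_lt_0_compat]).
  unfold Rpower in E; rewrite !ln_exp in E; lra.
Qed.

(* ln (euler_seq z k) increases, while ln (euler_seq z k) + z (1 + z) / k decreases. *)
Lemma euler_seq_cv (z : R) : 0 < z ->
  exists g : R, 0 < g /\ is_lim_seq (euler_seq z) g.
Proof.
  intros Hz.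
  assert (Hinc : forall k, ln (euler_seq z (S k)) <= ln (euler_seq z (S (S k)))).
  { intros k; pose proof (ln_euler_seq_step z k Hz); pose proof (pos_INR k).
    pose proof (ln_le_sub ((INR k + 1) / (INR k + 2))) as H1.
    pose proof (ln_le_sub ((z + INR k + 2) / (INR k + 2))) as H2.
    assert (0 < (INR k + 1) / (INR k + 2)) by (apply Rdiv_lt_0_compat; lra).
    assert (0 < (z + INR k + 2) / (INR k + 2)) by (apply Rdiv_lt_0_compat; lra).
    rewrite ln_div in H1, H2, H by lra.
    rewrite ln_div in H by lra.
    assert (E1 : (INR k + 1) / (INR k + 2) - 1 = - (/ (INR k + 2))) by (field; lra).
    assert (E2 : (z + INR k + 2) / (INR k + 2) - 1 = z * / (INR k + 2)) by (field; lra).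
    rewrite E1 in H1; rewrite E2 in H2.
    specialize (H1 H3); specialize (H2 H4).
    assert (z * / (INR k + 2) <= z * (ln (INR k + 2) - ln (INR k + 1)))
      by (apply Rmult_le_compat_l; lra).
    lra. }
  (* By ln y <= y - 1 the increment is at most z / (k + 1) - z / (z + k + 2) = z (1 + z) / ((k + 1)
     (z + k + 2)), which is below the telescoping C / (k + 1) - C / (k + 2). *)
  set (C := z * (1 + z)).
  assert (Hdec : forall k, ln (euler_seq z (S (S k))) + C / (INR k + 2)
                        <= ln (euler_seq z (S k)) + C / (INR k + 1)).
  { intros k; pose proof (ln_euler_seq_step z k Hz); pose proof (pos_INR k).
    pose proof (ln_le_sub ((INR k + 2) / (INR k + 1))) as H1.
    pose proof (ln_le_sub ((INR k + 2) / (z + INR k + 2))) as H2.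
    assert (0 < (INR k + 2) / (INR k + 1)) by (apply Rdiv_lt_0_compat; lra).
    assert (0 < (INR k + 2) / (z + INR k + 2)) by (apply Rdiv_lt_0_compat; lra).
    rewrite ln_div in H1, H2, H by lra.
    rewrite ln_div in H by lra.
    specialize (H1 H3); specialize (H2 H4).
    assert (z * (ln (INR k + 2) - ln (INR k + 1)) <= z * ((INR k + 2) / (INR k + 1) - 1))
      by (apply Rmult_le_compat_l; lra).
    assert (E : z * ((INR k + 2) / (INR k + 1) - 1) + ((INR k + 2) / (z + INR k + 2) - 1)
       <= C / (INR k + 1) - C / (INR k + 2)).
    { assert (D : C / (INR k + 1) - C / (INR k + 2)
        - (z * ((INR k + 2) / (INR k + 1) - 1) + ((INR k + 2) / (z + INR k + 2) - 1))
        = C * z / ((INR k + 1) * (INR k + 2) * (z + INR k + 2)))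
        by (unfold C; field; lra).
      assert (0 <= C * z / ((INR k + 1) * (INR k + 2) * (z + INR k + 2))).
      { unfold C; apply Rlt_le, Rdiv_lt_0_compat; repeat apply Rmult_lt_0_compat; lra. }
      lra. }
    lra. }
  assert (Hle : forall k, ln (euler_seq z (S k)) <= ln (euler_seq z 1) + C).
  { intros k.
    assert (H : ln (euler_seq z (S k)) + C / (INR k + 1) <= ln (euler_seq z 1) + C).
    { induction k as [|k IH]; [cbn [INR]; lra|].
      specialize (Hdec k); rewrite S_INR.
      replace (INR k + 1 + 1) with (INR k + 2) by ring; lra. }
    assert (0 < C / (INR k + 1)).
    { pose proof (pos_INR k); apply Rdiv_lt_0_compat; [unfold C; nra|lra]. }
    lra. }
  assert (ex : ex_finite_lim_seq (fun k => ln (euler_seq z (S k)))).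
  { apply ex_finite_lim_seq_incr with (ln (euler_seq z 1) + C); auto. }
  destruct ex as [L HL].
  exists (exp L); split; [apply exp_pos|].
  apply is_lim_seq_incr_1.
  apply (is_lim_seq_ext (fun k => exp (ln (euler_seq z (S k))))).
  - intros k; apply exp_ln, euler_seq_pos, Hz.
  - apply is_lim_seq_continuous; [|exact HL].
    apply derivable_continuous_pt, derivable_pt_exp.
Qed.

Lemma Gamma_is_lim (z : R) : 0 < z -> is_lim_seq (euler_seq z) (Gamma z) /\ 0 < Gamma z.
Proof.
  intros Hz; destruct (euler_seq_cv z Hz) as [g [Hg H]].
  replace (Gamma z) with g; [auto|].
  change (g = real (Lim_seq (euler_seq z))).
  now rewrite (is_lim_seq_unique _ _ H).
Qed.

Lemma Gamma_succ (z : R) : 0 < z -> Gamma (z + 1) = z * Gamma z.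
Proof.
  intros Hz.
  destruct (Gamma_is_lim z Hz) as [H _].
  destruct (Gamma_is_lim (z + 1)) as [H' _]; [lra|].
  enough (G : is_lim_seq (euler_seq (z + 1)) (z * Gamma z)).
  { apply is_lim_seq_unique in H'; apply is_lim_seq_unique in G.
    rewrite H' in G; now injection G. }
  assert (L : is_lim_seq (fun k => 1 - (z + 1) * / (INR k + (z + 1))) 1).
  { replace (Finite 1) with (Finite (1 - (z + 1) * 0)) by (f_equal; ring).
    apply is_lim_seq_minus'; [apply is_lim_seq_const|].
    apply is_lim_seq_mult'; [apply is_lim_seq_const|].
    replace (Finite 0) with (Rbar_inv p_infty) by reflexivity.
    apply is_lim_seq_inv; [|discriminate].
    eapply is_lim_seq_plus; [apply is_lim_seq_INR|apply is_lim_seq_const|reflexivity]. }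
  (* The quotient of the two Euler sequences is z k / (k + z + 1), which tends to z; k >= 1 is
     needed for [Rpower]. *)
  apply (is_lim_seq_ext_loc (fun k => z * euler_seq z k * (1 - (z + 1) * / (INR k + (z + 1))))).
  - exists 1%nat; intros k Hk; unfold euler_seq.
    assert (0 < INR k) by (apply lt_0_INR; lia).
    rewrite Rpower_plus, Rpower_1 by auto.
    rewrite (rising_S_left z); cbn [rising].
    assert (0 < rising (z + 1) k) by (apply rising_pos; lra).
    field; lra.
  - replace (Finite (z * Gamma z)) with (Finite (z * Gamma z * 1)) by (f_equal; ring).
    apply is_lim_seq_mult'; [|exact L].
    apply is_lim_seq_mult'; [apply is_lim_seq_const|exact H].
Qed.

Lemma Gamma_add (z : R) (k : nat) : 0 < z -> Gamma (z + INR k) = rising z k * Gamma z.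
Proof.
  intros Hz; induction k as [|k IH].
  - cbn; rewrite Rplus_0_r; ring.
  - rewrite S_INR, <- Rplus_assoc, Gamma_succ, IH by (pose proof (pos_INR k); lra).
    cbn [rising]; ring.
Qed.

(** Both branches of [poch] equal Gamma(c + a) / Gamma(c + b), so the sign of a - b is immaterial.
    In [dcoef] the index n - j - 2 can indeed be negative; there c = 2 lambda + 1. *)
Lemma poch_diff (c : R) (a b : nat) : 0 < c ->
  poch (c + INR b) (Z.of_nat a - Z.of_nat b) = rising c a / rising c b.
Proof.
  intros Hc; destruct (le_lt_dec b a) as [H|H].
  - replace (Z.of_nat a - Z.of_nat b)%Z with (Z.of_nat (a - b)) by lia.
    rewrite poch_of_nat.
    replace a with (b + (a - b))%nat at 2 by lia.
    rewrite rising_add.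
    assert (0 < rising c b) by now apply rising_pos.
    field; lra.
  - unfold poch; replace (0 <=? Z.of_nat a - Z.of_nat b)%Z with false
      by (symmetry; apply Z.leb_gt; lia).
    rewrite minus_IZR, <- !INR_IZR_INZ.
    replace (c + INR b + (INR a - INR b)) with (c + INR a) by ring.
    rewrite !Gamma_add by auto.
    destruct (Gamma_is_lim c Hc) as [_ Hg].
    assert (0 < rising c b) by now apply rising_pos.
    field; lra.
Qed.

(** * The convolution integral *)

Lemma is_derive_power_fact (k : nat) (u : R) :
  is_derive (fun u => u ^ S k / INR (fact (S k))) u (u ^ k / INR (fact k)).
Proof.
  pose proof (INR_fact_S k) as E; remember (INR (fact (S k))) as c.
  pose proof (pos_INR k); pose proof (INR_fact_neq_0 k).
  auto_derive; [exact I|]; cbn [pred].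
  change (match k with 0%nat => 1 | S _ => INR k + 1 end) with (INR (S k)).
  rewrite E, S_INR; field; lra.
Qed.

Lemma continuous_power_fact (k : nat) (u : R) :
  continuous (fun u => u ^ k / INR (fact k)) u.
Proof.
  apply (ex_derive_continuous (fun u => u ^ k / INR (fact k))).
  auto_derive; exact I.
Qed.

(** A Beta integral, by induction on i: integration by parts moves one power from s - u to u, and
    the boundary term [F] vanishes at 0 and at s. The sign of s is arbitrary. *)
Lemma is_RInt_convolution_powers (s : R) (i k : nat) :
  is_RInt (fun u => (s - u) ^ i / INR (fact i) * (u ^ k / INR (fact k))) 0 s
    (s ^ (i + k + 1) / INR (fact (i + k + 1))).
Proof.
  revert k; induction i as [|i IH]; intros k.
  - apply (is_RInt_ext (fun u => u ^ k / INR (fact k))).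
    { intros u _; cbn; field; apply INR_fact_neq_0. }
    replace (0 + k + 1)%nat with (S k) by lia.
    replace (s ^ S k / INR (fact (S k))) with
      (minus (s ^ S k / INR (fact (S k))) (0 ^ S k / INR (fact (S k))))
      by (unfold minus, plus, opp; cbn [AbelianGroup.opp]; rewrite (pow_i (S k)) by lia; 
          cbn; unfold Rdiv; ring).
    apply (is_RInt_derive (fun u => u ^ S k / INR (fact (S k)))).
    + intros u _; apply is_derive_power_fact.
    + intros u _; apply continuous_power_fact.
  - replace (s ^ (S i + k + 1) / INR (fact (S i + k + 1))) with
      (plus (s ^ (i + S k + 1) / INR (fact (i + S k + 1))) 0)
      by (unfold plus; cbn [AbelianMonoid.plus]; replace (i + S k + 1)%nat with (S i + k + 1)%nat by lia;
          cbn; ring).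
    set (F := fun u => (s - u) ^ S i / INR (fact (S i)) * (u ^ S k / INR (fact (S k)))).
    set (dF := fun u => (s - u) ^ S i / INR (fact (S i)) * (u ^ k / INR (fact k))
      - (s - u) ^ i / INR (fact i) * (u ^ S k / INR (fact (S k)))).
    apply (is_RInt_ext (fun u => plus
      ((s - u) ^ i / INR (fact i) * (u ^ S k / INR (fact (S k)))) (dF u))).
    { intros u _; unfold dF, plus; cbn -[pow fact INR]; ring. }
    apply (is_RInt_plus (V := R_NormedModule)); [apply IH|].
    replace 0 with (minus (F s) (F 0)) at 2.
    + apply (is_RInt_derive F).
      * intros u _; unfold F, dF.
        apply (is_derive_ext (fun u => (u ^ S k / INR (fact (S k))) * ((s - u) ^ S i / INR (fact (S i))))).
        { intros t; exact (Rmult_comm _ _). }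
        match goal with |- is_derive _ _ ?d => replace d with (plus (mult (u ^ k / INR (fact k)) ((s - u) ^ S i / INR (fact (S i))))
          (mult (u ^ S k / INR (fact (S k))) (scal (-1) ((s - u) ^ i / INR (fact i)))))
          by (unfold plus, mult, scal; cbn -[pow fact INR]; unfold mult; cbn -[pow fact INR]; ring) end.
        apply (is_derive_mult (fun u : R => u ^ S k / INR (fact (S k)))
          (fun u => (s - u) ^ S i / INR (fact (S i)))).
        -- apply is_derive_power_fact.
        -- apply (is_derive_comp (fun v => v ^ S i / INR (fact (S i))) (fun u => s - u)).
           ++ apply is_derive_power_fact.
           ++ auto_derive; [exact I|ring].
        -- intros; apply Rmult_comm.
      * intros u _; apply (ex_derive_continuous dF); unfold dF.
        auto_derive; exact I.
    + unfold minus, plus, opp, F; cbn -[pow fact INR].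
      rewrite Rminus_diag, !pow_i by lia; unfold Rdiv; ring.
Qed.

Lemma is_RInt_sum_f_R0 (f : nat -> R -> R) (v : nat -> R) (a b : R) (N : nat) :
  (forall i, is_RInt (f i) a b (v i)) ->
  is_RInt (fun t => sum_f_R0 (fun i => f i t) N) a b (sum_f_R0 v N).
Proof.
  intros H; induction N as [|N IH]; cbn [sum_f_R0]; [apply H|].
  apply (is_RInt_plus (V := R_NormedModule)); [exact IH|apply H].
Qed.

Lemma RInt_gegenbauer_convolution (l : R) (m n : nat) (x : R) :
  - (1 / 2) < l ->
  RInt (fun t => gegenbauer l m (x - t) * gegenbauer l n t) (-1) (x + 1)
  = sum_f_R0 (fun k => sum_f_R0 (fun i => taylor_coef l m i * taylor_coef l n k
      * ((x + 1 + 1) ^ (i + k + 1) / INR (fact (i + k + 1)))) m) n.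
Proof.
  intros Hl; apply is_RInt_unique.
  apply (is_RInt_ext (fun t => sum_f_R0 (fun k => sum_f_R0 (fun i =>
    taylor_coef l m i * taylor_coef l n k *
    ((x + 1 - t) ^ i / INR (fact i) * ((t + 1) ^ k / INR (fact k)))) m) n)).
  - intros t _.
    rewrite (gegenbauer_taylor l m m), (gegenbauer_taylor l n n), scal_sum by auto.
    apply sum_eq; intros k _.
    rewrite (Rmult_comm _ (sum_f_R0 _ _)), Rmult_comm, scal_sum; apply sum_eq; intros i _.
    replace (x - t + 1) with (x + 1 - t) by ring; ring.
  - apply (is_RInt_sum_f_R0 (fun k t => sum_f_R0 (fun i => _) m)); intros k.
    apply (is_RInt_sum_f_R0 (fun i t => _)); intros i.
    apply (is_RInt_scal (V := R_NormedModule)).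
    (* Substitution u = t + 1: the limits -1 and x + 1 become 0 and x + 2, and x - t + 1 becomes x +
       2 - u. *)
    apply (is_RInt_ext (fun t => scal 1
      ((fun u => (x + 1 + 1 - u) ^ i / INR (fact i) * (u ^ k / INR (fact k))) (1 * t + 1)))).
    + intros t _; unfold scal; cbn -[pow fact INR]; unfold mult; cbn -[pow fact INR].
      replace (x + 1 + 1 - (1 * t + 1)) with (x + 1 - t) by ring.
      rewrite !Rmult_1_l; reflexivity.
    + refine (is_RInt_comp_lin (V := R_NormedModule) (fun u => (x + 1 + 1 - u) ^ i
        / INR (fact i) * (u ^ k / INR (fact k))) 1 1 (-1) (x + 1) _ _).
      replace (1 * -1 + 1) with 0 by ring.
      replace (1 * (x + 1) + 1) with (x + 1 + 1) by ring.
      apply is_RInt_convolution_powers.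
Qed.

(** * Coefficients of the convolution *)

(** Convolving with u^k / k! is integrating k + 1 times from -1, hence [S k]; the nu of the theorem
    is k + 1. *)
Definition convolution_coef (l : R) (m n j : nat) : R :=
  sum_f_R0 (fun k => taylor_coef l m k * ((INR j + l) / l * antideriv_coef l n (S k) j)) m.

(** Both sides are the same double sum, since [power_coef] sees the two Taylor indices only through
    their sum. *)
Lemma convolution_coef_sym (l : R) (m n j : nat) :
  convolution_coef l m n j = convolution_coef l n m j.
Proof.
  unfold convolution_coef, antideriv_coef.
  transitivity (sum_f_R0 (fun k => sum_f_R0 (fun i => (INR j + l) / l *
    (taylor_coef l m k * taylor_coef l n i * power_coef l (i + S k) j)) n) m).
  - apply sum_eq; intros k _; rewrite <- Rmult_assoc, scal_sum.
    apply sum_eq; intros i _; ring.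
  - rewrite sum_f_R0_switch.
    apply sum_eq; intros i _; rewrite <- Rmult_assoc, scal_sum.
    apply sum_eq; intros k _.
    replace (k + S i)%nat with (i + S k)%nat by lia; ring.
Qed.

Lemma convolution_coef_spec (l : R) (m n : nat) :
  - (1 / 2) < l -> l <> 0 -> convolution_expansion l m n (convolution_coef l n m).
Proof.
  intros Hl Hl0 x; rewrite RInt_gegenbauer_convolution by auto.
  change (sum_n_m ?f 0 ?N) with (sum_n f N); rewrite sum_n_Reals.
  transitivity (sum_f_R0 (fun j => sum_f_R0 (fun k => sum_f_R0 (fun i =>
    taylor_coef l m i * taylor_coef l n k * ((INR j + l) / l
      * power_coef l (i + S k) j * gegenbauer l j (x + 1))) m) n) (m + n + 1)).
  - symmetry; rewrite <- sum_f_R0_switch; apply sum_eq; intros k Hk.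
    rewrite <- sum_f_R0_switch; apply sum_eq; intros i Hi; symmetry.
    rewrite (power_expansion l (x + 1) (i + k + 1) (m + n + 1)), scal_sum by (auto; lia).
    apply sum_eq; intros j _.
    replace (i + k + 1)%nat with (i + S k)%nat by lia; ring.
  - apply sum_eq; intros j _.
    unfold convolution_coef, antideriv_coef.
    rewrite (Rmult_comm _ (gegenbauer _ _ _)), scal_sum; apply sum_eq; intros k _.
    rewrite <- Rmult_assoc, Rmult_comm, <- !Rmult_assoc, scal_sum; apply sum_eq; intros i _; ring.
Qed.

Lemma convolution_coef_unique (l : R) (m n : nat) (rho : nat -> R) (j : nat) :
  - (1 / 2) < l -> l <> 0 -> convolution_expansion l m n rho ->
  (j <= m + n + 1)%nat -> rho j = convolution_coef l m n j.
Proof.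
  intros Hl Hl0 Hrho Hj; rewrite convolution_coef_sym; apply Rminus_diag_uniq.
  apply (gegenbauer_independent l (fun j => rho j - convolution_coef l n m j) (m + n + 1));
    auto.
  intros y; pose proof (Hrho (y - 1)) as H1.
  pose proof (convolution_coef_spec l m n Hl Hl0 (y - 1)) as H2.
  rewrite H1 in H2; clear H1.
  change (sum_n_m ?f 0 ?N) with (sum_n f N) in H2; rewrite !sum_n_Reals in H2.
  replace (y - 1 + 1) with y in H2 by ring.
  apply Rminus_diag_eq in H2; rewrite <- minus_sum in H2; rewrite <- H2.
  apply sum_eq; intros; ring.
Qed.

(** * Identification with [varpi] and [dcoef] *)

(** Duplication splits (2 lambda)_(2k) into 4^k (lambda)_k (lambda + 1/2)_k, and the last factor
    cancels the denominator. This is the shape in which the coefficient occurs in [varpi]. *)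
Lemma taylor_coef_duplication (l : R) (m k : nat) :
  - (1 / 2) < l -> (k <= m)%nat ->
  taylor_coef l m k
  = (-1) ^ (m + k) * 2 ^ k * rising l k * rising (2 * l + 2 * INR k) (m - k)
    / INR (fact (m - k)).
Proof.
  intros Hl H; unfold taylor_coef; rewrite inv_fact_diff_le by auto.
  replace (m + k)%nat with (2 * k + (m - k))%nat at 2 by lia.
  rewrite rising_add, rising_duplication, mult_INR.
  replace (4 ^ k) with (2 ^ k * 2 ^ k) by (rewrite <- Rpow_mult_distr; f_equal; ring).
  change (INR 2) with 2.
  assert (0 < rising (l + 1 / 2) k) by (apply rising_pos; lra).
  assert (0 < 2 ^ k) by (apply pow_lt; lra).
  pose proof (INR_fact_neq_0 (m - k)).
  field; repeat split; lra.
Qed.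

Lemma varpi_odd (l : R) (m n j nu h : nat) :
  (n + nu = j + 2 * h + 1)%nat -> varpi l m n j nu = 0.
Proof.
  intros H; unfold varpi.
  replace (Z.of_nat n + Z.of_nat nu - Z.of_nat j)%Z with (2 * Z.of_nat h + 1)%Z by lia.
  now rewrite Z.even_add, Z.even_mul.
Qed.

(** The power 2^k of the Taylor coefficient against 2^(k+1) in the closed form leaves the 1/2 of
    [varpi], and lambda cancels. From j = n + nu - 2h one gets (j + n - nu) / 2 = n - h. *)
Lemma varpi_even (l : R) (m n j k h : nat) :
  - (1 / 2) < l -> l <> 0 -> (k <= m)%nat -> (S k <= j)%nat ->
  (n + S k = j + 2 * h)%nat ->
  varpi l m n j (S k)
  = taylor_coef l m k * ((INR j + l) / l * antideriv_coef l n (S k) j).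
Proof.
  intros Hl Hl0 Hk Hj Hh; unfold varpi.
  replace (Z.of_nat n + Z.of_nat (S k) - Z.of_nat j)%Z with (2 * Z.of_nat h)%Z by lia.
  rewrite Z.even_mul; cbn [Z.even orb].
  replace (2 * Z.of_nat h / 2)%Z with (Z.of_nat h)
    by (rewrite Z.mul_comm, Z.div_mul; lia).
  replace (Z.of_nat (S k) - 1)%Z with (Z.of_nat k) by lia.
  replace (Z.of_nat m - Z.of_nat (S k) + 1)%Z with (Z.of_nat (m - k)) by lia.
  replace (Z.of_nat (S k) + 1)%Z with (Z.of_nat (S (S k))) by lia.
  rewrite !poch_of_nat, Nat2Z.id.
  rewrite (antideriv_coef_even l n (S k) j h) by auto.
  rewrite taylor_coef_duplication by auto.
  replace (m + 1 - S k)%nat with (m - k)%nat by lia.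
  replace (m + S k + 1)%nat with (S (S (m + k))) by lia.
  assert (Hi : INR n + INR k + 1 = INR j + 2 * INR h).
  { apply (f_equal INR) in Hh; rewrite !plus_INR, S_INR, mult_INR in Hh; cbn [INR] in Hh; lra. }
  replace (2 * l + 2 * INR (S k) - 2) with (2 * l + 2 * INR k) by (rewrite S_INR; ring).
  replace (l + (INR j + INR n - INR (S k)) / 2) with (l + (INR n - INR h))
    by (rewrite S_INR; lra).
  assert (0 < 2 ^ k) by (apply pow_lt; lra).
  assert (rising (l + (INR n - INR h)) (S (S k)) <> 0).
  { assert (Hn : (2 * h <= n)%nat) by lia.
    apply le_INR in Hn; rewrite mult_INR in Hn; cbn [INR] in Hn.
    pose proof (pos_INR h).
    assert (HA : l + (INR n - INR h) <> 0).
    { destruct h as [|h]; [|rewrite S_INR in *; pose proof (pos_INR h); lra].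
      cbn [INR] in *; destruct n as [|n]; [cbn in *; lra|].
      rewrite S_INR; pose proof (pos_INR n); lra. }
    rewrite rising_S_left; apply Rmult_integral_contrapositive_currified; [exact HA|].
    apply Rgt_not_eq, rising_pos; lra. }
  pose proof (INR_fact_neq_0 h); pose proof (INR_fact_neq_0 (m - k)).
  cbn [pow]; field; repeat split; auto; lra.
Qed.

Lemma varpi_antideriv (l : R) (m n j k : nat) :
  - (1 / 2) < l -> l <> 0 -> (k <= m)%nat -> (S k <= j)%nat -> (j <= n + S k)%nat ->
  varpi l m n j (S k)
  = taylor_coef l m k * ((INR j + l) / l * antideriv_coef l n (S k) j).
Proof.
  intros Hl Hl0 Hk Hj Hn.
  destruct (Nat.Even_or_Odd (n + S k - j)) as [[h Hh]|[h Hh]].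
  - apply (varpi_even l m n j k h); auto; lia.
  - rewrite (varpi_odd l m n j (S k) h), (antideriv_coef_odd l n (S k) j h) by (auto; lia).
    ring.
Qed.

(** With nu moves the index cannot fall below n - nu: in the closed form h > nu, and (-nu)_h = 0. *)
Lemma antideriv_coef_lt (l : R) (n nu j : nat) :
  - (1 / 2) < l -> l <> 0 -> (nu <= j)%nat -> (j + nu < n)%nat ->
  antideriv_coef l n nu j = 0.
Proof.
  intros Hl Hl0 Hj Hn.
  destruct (Nat.Even_or_Odd (n + nu - j)) as [[h Hh]|[h Hh]].
  - rewrite (antideriv_coef_even l n nu j h) by (auto; lia).
    rewrite rising_opp_INR, inv_fact_diff_gt by lia; unfold Rdiv; ring.
  - apply (antideriv_coef_odd l n nu j h); auto; lia.
Qed.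

Lemma fact_add (p i : nat) :
  INR (fact (p + i)) = INR (fact p) * rising (INR p + 1) i.
Proof.
  induction i as [|i IH].
  - rewrite Nat.add_0_r; cbn; ring.
  - rewrite Nat.add_succ_r, INR_fact_S, IH, plus_INR; cbn [rising]; ring.
Qed.

(** The parameter -m stops the 4F3 at i = m, and its i-th term matches the contribution of the i-th
    Taylor coefficient of C_m. *)
Lemma dcoef_antideriv (l : R) (m n j k : nat) :
  - (1 / 2) < l -> l <> 0 -> (1 <= n)%nat -> (j <= k)%nat -> (k <= n)%nat ->
  dcoef l m n j (S k)
  = taylor_coef l n k * ((INR j + l) / l * antideriv_coef l m (S k) j).
Proof.
  intros Hl Hl0 Hn Hj Hk; unfold dcoef, hypergeom.
  rewrite (Series_finite _ m).
  2:{ intros i Hi; unfold poch_list; cbn [map fold_right]; rewrite !poch_of_nat.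
      rewrite rising_opp_INR, inv_fact_diff_gt by lia; unfold Rdiv; ring. }
  (* Splitting the index so that both rising factorials start at 2 lambda + 1; n >= 1 makes n + k -
     1 exact. *)
  replace (- Z.of_nat j + Z.of_nat n - 2)%Z
    with (Z.of_nat (n + k - 1) - Z.of_nat (j + S k))%Z by lia.
  replace (INR j + 2 * l + INR (S k) + 1) with (2 * l + 1 + INR (j + S k))
    by (rewrite plus_INR; ring).
  rewrite poch_diff, poch_of_nat by lra.
  unfold antideriv_coef; rewrite scal_sum, <- Rmult_assoc.
  rewrite !scal_sum.
  unfold taylor_coef at 2.
  apply sum_eq; intros i Hi.
  unfold poch_list; cbn [map fold_right]; rewrite !poch_of_nat.
  rewrite pow1.
  (* The numerator parameter 1 cancels the i! of the hypergeometric series. *)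
  replace (rising 1 i) with (INR (fact i))
    by (rewrite <- (Nat.add_0_l i) at 1; rewrite fact_add; cbn; rewrite Rplus_0_l; ring).
  rewrite (rising_opp_INR m i); unfold taylor_coef, power_coef.
  replace (INR m + 2 * l) with (2 * l + INR m) by ring.
  replace (l + INR (S k) + 1 / 2) with (l + 1 / 2 + INR (S k)) by ring.
  replace (- INR j + INR (S k) + 1) with (INR (S k - j) + 1)
    by (rewrite minus_INR by lia; ring).
  replace (i + S k + j)%nat with (j + S k + i)%nat by lia.
  replace (i + S k)%nat with (S k + i)%nat by lia.
  replace (n + 1 - S k)%nat with (n - k)%nat by lia.
  replace (m + S k + n + 1)%nat with (S (S (m + (n + k)))) by lia.
  rewrite (rising_add (2 * l) m i), (rising_add (l + 1 / 2) (S k) i),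
    (rising_add (2 * l + 1) (j + S k) i).
  rewrite (inv_fact_diff_le (S k + i) j), (inv_fact_diff_le n k) by lia.
  replace (S k + i - j)%nat with (S k - j + i)%nat by lia.
  rewrite fact_add.
  (* The 2 lambda split off here meets 1 / lambda and gives the leading 2 of [dcoef]; the factor
     lambda + 1/2 + k split off next gives, with 2^(k+1) / 2^k, the factor 2 lambda + 2 nu - 1. *)
  replace (rising (2 * l) (n + k)) with (2 * l * rising (2 * l + 1) (n + k - 1))
    by (rewrite <- rising_S_left; f_equal; lia).
  change (rising (l + 1 / 2) (S k)) with (rising (l + 1 / 2) k * (l + 1 / 2 + INR k)).
  rewrite (pow_add (-1) m i), (pow_add 2 (S k) i), S_INR.
  assert (0 < 2 ^ k) by (apply pow_lt; lra).
  assert (0 < 2 ^ i) by (apply pow_lt; lra).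
  pose proof (pos_INR k).
  assert (0 < rising (l + 1 / 2) k) by (apply rising_pos; lra).
  assert (0 < rising (l + 1 / 2) i) by (apply rising_pos; lra).
  assert (0 < rising (INR (S k - j) + 1) i)
    by (apply rising_pos; pose proof (pos_INR (S k - j)); lra).
  assert (0 < rising (2 * l + 1) (j + S k)) by (apply rising_pos; lra).
  assert (0 < rising (2 * l + 1 + INR (j + S k)) i)
    by (apply rising_pos; pose proof (pos_INR (j + S k)); lra).
  pose proof (INR_fact_neq_0 i); pose proof (INR_fact_neq_0 m).
  pose proof (INR_fact_neq_0 (S k - j)); pose proof (INR_fact_neq_0 (n - k)).
  cbn [pow]; rewrite (pow_add (-1) m (n + k)).
  field; repeat split; lra.
Qed.

(** * The three ranges of j *)

Lemma sum_n_m_drop_zeros (f : nat -> R) (a b c : nat) :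
  (a <= c)%nat -> (c <= S b)%nat ->
  (forall i, (a <= i < c)%nat -> f i = 0) ->
  sum_n_m f a b = sum_n_m f c b.
Proof.
  intros Hac Hcb Hf; induction Hac as [|c Hac IH]; [reflexivity|].
  rewrite IH by (try lia; intros; apply Hf; lia).
  rewrite (sum_Sn_m f c b) by lia.
  rewrite Hf by lia; apply Rplus_0_l.
Qed.

Theorem corollary3p9 :
  forall (m n : nat) (lambda : R),
    (1 <= m)%nat -> (1 <= n)%nat -> (m <= n)%nat ->
    - (1 / 2) < lambda -> lambda <> 0 ->
    (exists rho : nat -> R, convolution_expansion lambda m n rho)
    /\
    forall rho : nat -> R,
      convolution_expansion lambda m n rho ->
      (forall j : nat,
         (Nat.max (m + 1) (n - m - 1) <= j)%nat -> (j <= m + n + 1)%nat ->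
         rho j = sum_n_m (fun nu => varpi lambda m n j nu)
                   (Nat.max 1 (Z.abs_nat (Z.of_nat j - Z.of_nat n))) (m + 1))
      /\
      ((2 * m + 3 <= n)%nat ->
       forall j : nat,
         (m + 1 <= j)%nat -> (j <= n - m - 2)%nat -> rho j = 0)
      /\
      (forall j : nat,
         (j <= m)%nat ->
         rho j = sum_n_m (fun nu => varpi lambda n m j nu) 1 j
                 + sum_n_m (fun nu => dcoef lambda m n j nu) (j + 1) (n + 1)).
Proof.
  intros m n l Hm Hn Hmn Hl Hl0.
  split; [eexists; apply convolution_coef_spec; auto|].
  intros rho Hrho.
  assert (E : forall j, (j <= m + n + 1)%nat -> rho j = convolution_coef l m n j)
    by (intros; now apply convolution_coef_unique).
  assert (S1 : forall p q j, convolution_coef l p q j = sum_n_m (fun nu =>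
    taylor_coef l p (pred nu) * ((INR j + l) / l * antideriv_coef l q nu j)) 1 (p + 1)).
  { intros p q j; rewrite Nat.add_1_r, <- sum_n_m_S; cbn [pred].
    change (sum_n_m ?f 0 p) with (sum_n f p); now rewrite sum_n_Reals. }
  split; [|split].
  - intros j Hj Hj'; rewrite E, S1 by auto.
    (* For nu < |j - n| the index j is out of reach from n in nu moves, on either side. *)
    rewrite (sum_n_m_drop_zeros _ 1 (m + 1)
      (Nat.max 1 (Z.abs_nat (Z.of_nat j - Z.of_nat n)))) by
      first [lia | intros i Hi; destruct (le_lt_dec j n);
        [rewrite antideriv_coef_lt by (auto; lia)|rewrite antideriv_coef_gt by lia]; ring].
    apply sum_n_m_ext_loc; intros [|k] Hk; [lia|].
    symmetry; apply varpi_antideriv; auto; lia.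
  (* Here every nu <= m + 1 satisfies nu <= j and j + nu < n, so all terms vanish. *)
  - intros Hn' j Hj Hj'; rewrite E by lia; unfold convolution_coef.
    rewrite (sum_eq _ (fun _ => 0)), sum_cte; [ring|].
    intros k Hk; rewrite antideriv_coef_lt by (auto; lia); ring.
  (* After the exchange nu runs to n + 1 over the Taylor coefficients of C_n and is split at j:
     closed form up to j, 4F3 beyond. The bound j <= m makes j <= m + nu, as [varpi_antideriv]
     requires. *)
  - intros j Hj; rewrite E, convolution_coef_sym, S1 by lia.
    rewrite (sum_n_m_Chasles _ 1 j (n + 1)) by lia.
    replace (S j) with (j + 1)%nat by lia.
    apply f_equal2; apply sum_n_m_ext_loc; intros [|k] Hk; try lia; symmetry.
    + apply varpi_antideriv; auto; lia.
    + apply dcoef_antideriv; auto; lia.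
Qed.
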